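(* Let $(a(n))_{n\ge 1}$ be the Binary Enots Wolley sequence. Every positive integer $n$ with $s_2(n)\geq 2$ appears in the sequence; that is, for every positive integer $n$ with $s_2(n)\ge 2$ there exists $i\ge 1$ such that $a(i)=n$.
   Context: For a positive integer $k$, $\operatorname{supp}(k)$ denotes the set of positions of the $1$s in the binary expansion of $k$ (positions are numbered from $0$, so $\operatorname{supp}(15)=\{0,1,2,3\}$ and $\operatorname{supp}(1)=\{0\}$), and $s_2(k)=|\operatorname{supp}(k)|$ is the binary weight of $k$, i.e. the number of $1$s in its binary expansion. The Binary Enots Wolley sequence $(a(n))_{n\ge1}$ is the lexicographically earliest infinite sequence of distinct positive integers such that, whenever the terms referred to exist, the binary expansions of $a(n)$ and $a(n-1)$ have a $1$ in a common position ($\operatorname{supp}(a(n))\cap\operatorname{supp}(a(n-1))\ne\emptyset$ for $n\ge 2$), while the positions of the $1$s in the binary expansions of $a(n)$ and $a(n-2)$ are disjoint ($\operatorname{supp}(a(n))\cap\operatorname{supp}(a(n-2))=\emptyset$ for $n\ge 3$). The sequence begins $1,3,6,12,9,17,18,\dots$. *)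

(* Defs.v *)
From mathcomp Require Import all_boot.
From mathcomp Require Import finmap.
From Stdlib Require ClassicalEpsilon.

Set Implicit Arguments.
Unset Strict Implicit.
Unset Printing Implicit Defensive.

Local Open Scope fset_scope.

(* A position i of a 1 in k satisfies i < 2 ^ i <= k, so the positions below k
   suffice; see in_supp. *)
Definition supp (k : nat) : {fset nat} :=
  [fset i in iota 0 k | odd (k %/ 2 ^ i)].

Definition s2 (k : nat) : nat := #|` supp k|.

(* Sequences are indexed from 1: the value at 0 is never constrained. *)
Definition enots_wolley_admissible (a : nat -> nat) : Prop :=
  [/\ forall n, 1 <= n -> 0 < a n,
      forall m n, 1 <= m -> 1 <= n -> a m = a n -> m = n,
      forall n, 2 <= n -> supp (a n) `&` supp (a (n - 1)) != fset0
    & forall n, 3 <= n -> supp (a n) `&` supp (a (n - 2)) = fset0].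

Definition lex_le (a b : nat -> nat) : Prop :=
  (forall n, 1 <= n -> a n = b n) \/
  (exists n, [/\ 1 <= n, forall m, 1 <= m < n -> a m = b m & a n < b n]).

(* Minimality is over infinite sequences: a finite prefix with no infinite
   admissible continuation, such as 1, 3, 2, is excluded. *)
Definition binary_enots_wolley (a : nat -> nat) : Prop :=
  enots_wolley_admissible a /\
  (forall b, enots_wolley_admissible b -> lex_le a b).

Lemma in_supp (k i : nat) : (i \in supp k) = odd (k %/ 2 ^ i).
Proof.
rewrite !inE /= mem_iota /= add0n; case: ltnP => //= le_ki.
by rewrite divn_small // (leq_ltn_trans le_ki) // ltn_expl.
Qed.

Lemma binary_enots_wolley_unique (a b : nat -> nat) :
  binary_enots_wolley a -> binary_enots_wolley b ->
  forall n, 1 <= n -> a n = b n.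
Proof.
move=> [aA aM] [bA bM].
case: (aM b bA) => // -[n [n1 eqn ltn]].
case: (bM a aA) => [eqba k k1|[m [m1 eqm ltm]]]; first by rewrite eqba.
case: (ltngtP m n) => [lt|lt|e].
- by move: ltm; rewrite (eqn m) ?m1 // ltnn.
- by move: ltn; rewrite (eqm n) ?n1 // ltnn.
- by move: ltm; rewrite e ltnNge (ltnW ltn).
Qed.

Lemma in_supp_3exp (n i : nat) :
  (i \in supp (3 * 2 ^ n)) = (i == n) || (i == n.+1).
Proof.
rewrite in_supp; case: (ltngtP i n) => [lt|lt|->].
- rewrite -{1}(subnK (ltnW lt)) expnD mulnA mulnK ?expn_gt0 //.
  rewrite oddM oddX /= orbF subn_eq0 leqNgt lt /=.
  by apply/esym/eqP => e; rewrite e ltnNge leqnSn in lt.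
- rewrite -{1}(subnK (ltnW lt)) expnD divnMr ?expn_gt0 // orFb.
  have -> : (i == n.+1) = (i - n == 1) by rewrite -[RHS](eqn_add2r n) subnK ?(ltnW lt).
  have: 0 < i - n by rewrite subn_gt0.
  case: (i - n) => [|[|j]] // _.
  by rewrite divn_small // !expnS mulnA (@leq_mul 4 1) ?expn_gt0.
- by rewrite mulnK ?expn_gt0.
Qed.

Lemma admissible_3exp : enots_wolley_admissible (fun n => 3 * 2 ^ n).
Proof.
split=> [n _|m n _ _ /eqP|n n2|n n3].
- by rewrite muln_gt0 expn_gt0.
- by rewrite eqn_pmul2l // eqn_exp2l // => /eqP.
- apply/fset0Pn; exists n; rewrite in_fsetI !in_supp_3exp subn1.
  by rewrite prednK ?eqxx ?orbT // (ltnW n2).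
- apply/fsetP => i; rewrite in_fsetI !in_supp_3exp in_fset0.
  case: n n3 => [|[|n]] // _; rewrite !subSS subn0.
  by apply/negbTE/negP => /andP[/orP[]/eqP-> /orP[]];
    rewrite gtn_eqF // !ltnS ?leqnSn // -addn2 leq_addr.
Qed.

Definition agree_below (n : nat) (a b : nat -> nat) : Prop :=
  forall m, 1 <= m < n -> a m = b m.

Lemma least_continuation (n : nat) (c : nat -> nat) :
  enots_wolley_admissible c ->
  exists d, [/\ enots_wolley_admissible d, agree_below n c d
    & forall b, enots_wolley_admissible b -> agree_below n c b -> d n <= b n].
Proof.
move=> cA.
pose P v := exists d, [/\ enots_wolley_admissible d, agree_below n c d & d n = v].
pose p v : bool := if ClassicalEpsilon.excluded_middle_informative (P v)
                   then true else false.
have pP v : reflect (P v) (p v).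
  by rewrite /p; case: ClassicalEpsilon.excluded_middle_informative => ?; constructor.
have exp : exists v, p v by exists (c n); apply/pP; exists c; split.
case: (ex_minnP exp) => v /pP[d [dA cd dn]] vmin.
exists d; split=> // b bA cb; rewrite dn; apply: vmin.
by apply/pP; exists b; split.
Qed.

Lemma binary_enots_wolley_exists : exists a, binary_enots_wolley a.
Proof.
pose T := {c | enots_wolley_admissible c}.
have step (n : nat) (c : T) : {d : T | agree_below n (sval c) (sval d) /\
    forall b, enots_wolley_admissible b -> agree_below n (sval c) b ->
    sval d n <= b n}.
  apply: ClassicalEpsilon.constructive_indefinite_description.
  by have [d [dA cd dm]] := least_continuation n (svalP c); exists (exist _ d dA).
pose F := fix F n : T := if n is k.+1 then sval (step k.+1 (F k))
                         else exist _ _ admissible_3exp.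
have Fagree m n k : 1 <= k <= m -> m <= n -> sval (F n) k = sval (F m) k.
  move=> /andP[k1 km]; elim: n => [|n IH] mn.
    by move: (leq_trans km mn); rewrite leqNgt k1.
  move: mn; rewrite leq_eqVlt => /orP[/eqP->//|]; rewrite ltnS => mn.
  rewrite -(IH mn) /=; have [+ _] := svalP (step n.+1 (F n)) => ->//.
  by rewrite k1 ltnS (leq_trans km).
pose a n := sval (F n) n.
have aF n k : 1 <= k <= n -> a k = sval (F n) k.
  by move=> /andP[k1 kn]; rewrite (Fagree k n) ?k1 /=.
exists a; split; first split.
- by move=> n n1; have [+ _ _ _] := svalP (F n); apply.
- move=> m n m1 n1; rewrite (aF (maxn m n) m) ?m1 ?leq_maxl //.
  rewrite (aF (maxn m n) n) ?n1 ?leq_maxr //.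
  by have [_ + _ _] := svalP (F (maxn m n)); apply.
- move=> n n2; have [_ _ + _] := svalP (F n) => /(_ n n2).
  by rewrite (aF n (n - 1)) // subn_gt0 n2 leq_subr.
- move=> n n3; have [_ _ _] := svalP (F n) => /(_ n n3).
  by rewrite (aF n (n - 2)) // subn_gt0 n3 leq_subr.
move=> b bA.
case: (ClassicalEpsilon.excluded_middle_informative
  (exists n, (1 <= n) && (a n != b n))) => [ex|nex]; last first.
  left=> n n1; apply/eqP/negPn/negP => ne; apply: nex; exists n.
  by rewrite n1.
right; case: (ex_minnP ex) => -[//|n] /andP[_ ne] nmin.
have eqab : forall m, 1 <= m < n.+1 -> a m = b m.
  move=> m /andP[m1 mn]; apply/eqP/negPn/negP => ne'.
  by move: (nmin m); rewrite m1 ne' leqNgt mn => /(_ isT).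
exists n.+1; split=> //; rewrite ltn_neqAle ne /=.
have [_] := svalP (step n.+1 (F n)); apply=> // m /[dup] mn /eqab <-.
by rewrite (aF n).
Qed.

(* Main.v *)
(* Let A n be the set of bits of the n-th term. The sequence is greedy: the next
   term is the least unused number that meets A (n + 1), is disjoint from A n
   and is not contained in A (n + 1). Suppose K, with at least two bits, is
   missing. The terms tend to infinity, so late on K is never a candidate: a
   term that meets K after a term that does not must contain K. If infinitely
   many terms were disjoint from K, this would happen infinitely often, and
   minimality would force too many smaller terms to have been used before. So
   all late terms meet K, and every pair of large bits is missing as well;
   applying the same to three such pairs gives a contradiction. *)
Require Import Defs.
From mathcomp Require Import all_boot.
From mathcomp Require Import finmap zify.
From Stdlib Require Import Classical.

Set Implicit Arguments.
Unset Strict Implicit.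
Unset Printing Implicit Defensive.

Local Open Scope fset_scope.
Local Open Scope nat_scope.

(** * Finite sets of bits as numbers: [value] is the inverse of [supp] *)

Definition value (A : {fset nat}) : nat := \sum_(i <- A) 2 ^ i.

Lemma value_fsetU1 x A : x \notin A -> value (x |` A) = 2 ^ x + value A.
Proof. exact: big_fsetU1. Qed.

Lemma value_fsetD1 x A : x \in A -> value A = 2 ^ x + value (A `\ x).
Proof. exact: big_fsetD1. Qed.

Lemma value_fset1 x : value [fset x] = 2 ^ x.
Proof. exact: big_seq_fset1. Qed.

Lemma value_fset2 x y : x != y -> value [fset x; y] = 2 ^ x + 2 ^ y.
Proof. by move=> nxy; rewrite value_fsetU1 ?inE // value_fset1. Qed.

Lemma value_fsetU1_le x A : value (x |` A) <= 2 ^ x + value A.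
Proof.
have [xA|xA] := boolP (x \in A); last by rewrite value_fsetU1.
by rewrite [x |` A](fsetUidPr _ _ _) ?fsub1set ?leq_addl.
Qed.

Lemma value_subset A B : A `<=` B -> value A <= value B.
Proof.
move=> sAB; rewrite /value (big_fsetID _ (mem A) B) /=.
suff -> : [fset i in B | i \in A] = A by rewrite leq_addr.
by apply/fsetP => i; rewrite !inE /= andbC; case: (boolP (i \in A)) => // /(fsubsetP sAB).
Qed.

Lemma value_proper A B : A `<` B -> value A < value B.
Proof.
rewrite fproperE => /andP[sAB /fsubsetPn[x xB xA]]; rewrite (value_fsetD1 xB).
have/value_subset le : A `<=` B `\ x by rewrite fsubsetD1 sAB.
by rewrite (leq_ltn_trans le) // -[X in X < _]add0n ltn_add2r expn_gt0.
Qed.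

Lemma exp2_le_value x A : x \in A -> 2 ^ x <= value A.
Proof. by move=> /value_fsetD1->; rewrite leq_addr. Qed.

Lemma in_supp_exp2 i j : (i \in supp (2 ^ j)) = (i == j).
Proof.
rewrite in_supp; case: (ltngtP i j) => [lt|lt|->].
- by rewrite -expnB // ?(ltnW lt) // oddX /= orbF subn_eq0 leqNgt lt.
- by rewrite divn_small // ltn_exp2l.
- by rewrite divnn expn_gt0.
Qed.

(** Bit [j] of [k] is zero, so the addition causes no carry. *)
Lemma in_suppD_exp2 k j i : j \notin supp k ->
  (i \in supp (2 ^ j + k)) = (i == j) || (i \in supp k).
Proof.
rewrite !in_supp => nj; case: (ltngtP i j) => [lt|lt|->].
- have dv : 2 ^ i %| 2 ^ j by rewrite dvdn_exp2l // ltnW.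
  by rewrite divnDl // oddD -expnB // ?(ltnW lt) // oddX /= orbF subn_eq0 leqNgt lt.
- have -> : 2 ^ i = 2 ^ j * 2 * 2 ^ (i - j.+1).
    by rewrite -expnSr -expnD subnKC.
  rewrite !divnMA divnDl // divnn expn_gt0 add1n.
  by rewrite !divn2 -uphalfE uphalf_half (negbTE nj).
- by rewrite divnDl // divnn expn_gt0 oddD (negbTE nj).
Qed.

(** Strong induction by halving: bit 0 is the parity, and the other bits are those of the half,
    shifted by one. *)
Lemma value_supp k : value (supp k) = k.
Proof.
have supp2 m : supp m = (if odd m then [fset 0] else fset0) `|`
                        [fset i.+1 | i in supp m./2].
  apply/fsetP => -[|i]; rewrite in_fsetU in_supp.
    rewrite divn1; have/negbTE-> : 0 \notin [fset i.+1 | i in supp m./2].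
      by apply/imfsetP => -[].
    by case: (odd m); rewrite !inE.
  rewrite expnS divnMA divn2 -in_supp.
  have -> : (i.+1 \in (if odd m then [fset 0] else fset0)) = false.
    by case: ifP; rewrite !inE.
  by rewrite (mem_imfset _ _ succn_inj).
have valS (A : {fset nat}) : value [fset i.+1 | i in A] = (value A).*2.
  rewrite /value big_imfset /=; last by move=> ? ? _ _ [].
  by rewrite -mul2n big_distrr /=; apply: eq_bigr => i _; rewrite expnS.
elim/ltn_ind: k => -[|k] IH.
  by rewrite (_ : supp 0 = fset0) ?/value ?big_seq_fset0 //; apply/fsetP=> i; rewrite in_supp div0n inE.
rewrite -[RHS]odd_double_half supp2.
case: (boolP (odd k.+1)) => o.
  rewrite value_fsetU1 ?valS ?IH //; first by rewrite ltn_half_double; lia.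
  by apply/imfsetP => -[].
by rewrite fset0U valS IH // ltn_half_double; lia.
Qed.

Lemma supp_value A : supp (value A) = A.
Proof.
elim/fset1U_rect: A => [|x A xA IH].
  by apply/fsetP => i; rewrite /value big_seq_fset0 in_supp div0n inE.
by apply/fsetP => i; rewrite value_fsetU1 // in_suppD_exp2 IH // in_fset1U.
Qed.

Lemma supp_inj : injective supp.
Proof. exact: can_inj value_supp. Qed.

Lemma value_inj : injective value.
Proof. exact: can_inj supp_value. Qed.

Lemma mem_top_bit A b : 2 ^ b <= value A < 2 ^ b.+1 -> b \in A.
Proof.
move=> /andP[le lt]; rewrite -(supp_value A) in_supp.
suff -> : value A %/ 2 ^ b = 1 by [].
apply/eqP; rewrite eqn_leq divn_gt0 ?expn_gt0 // le andbT.
by rewrite -ltnS ltn_divLR ?expn_gt0 // -expnS.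
Qed.

(** * Common bits and bounds on bits *)

Lemma meetP (A B : {fset nat}) :
  reflect (exists2 x, x \in A & x \in B) (~~ [disjoint A & B]%fset).
Proof.
apply: (iffP (fset0Pn _)) => [[x]|[x xA xB]]; first by rewrite inE => /andP[]; exists x.
by exists x; rewrite inE xA.
Qed.

Lemma bits_bound (A : {fset nat}) : exists M, forall i, i \in A -> i < M.
Proof.
exists (value A) => i /exp2_le_value; apply: leq_trans.
by rewrite ltn_expl.
Qed.

Lemma bits_bound_prefix (A : nat -> {fset nat}) n :
  exists M, forall p i, p < n -> i \in A p -> i < M.
Proof.
elim: n => [|n [M hM]]; first by exists 0.
have [M' hM'] := bits_bound (A n).
exists (maxn M M') => p i; rewrite ltnS leq_max leq_eqVlt => /orP[/eqP->/hM'->|pn ip].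
  by rewrite orbT.
by rewrite (hM p).
Qed.

(** * The greedy rule, for sets indexed from 0 *)

Lemma admissible_value (B : nat -> {fset nat}) :
  injective B -> (forall n, B n != fset0) ->
  (forall n, ~~ [disjoint B n.+1 & B n]%fset) -> (forall n, [disjoint B n.+2 & B n]%fset) ->
  enots_wolley_admissible (fun m => value (B m.-1)).
Proof.
move=> Binj Bn0 Bmeet Bdisj; split.
- by move=> n _; have /fset0Pn[x /exp2_le_value] := Bn0 n.-1; apply: leq_trans; rewrite expn_gt0.
- by move=> [|m] [|n] // _ _ /value_inj/Binj /= ->.
- by move=> [|[|n]] // _; rewrite !supp_value subn1; apply: Bmeet.
- by move=> [|[|[|n]]] // _; rewrite !supp_value subn2; apply/eqP/Bdisj.
Qed.

(** In [gs_min], non-containment in [A n.+1] is what lets [C] be continued: the term after [C] must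
    meet [C] and avoid [A n.+1]. *)
Record greedy_sets (A : nat -> {fset nat}) : Prop := GreedySets {
  gs_inj : injective A;
  gs_meet : forall n, ~~ [disjoint A n.+1 & A n]%fset;
  gs_disj : forall n, [disjoint A n.+2 & A n]%fset;
  gs_min : forall n C, ~~ [disjoint C & A n.+1]%fset -> [disjoint C & A n]%fset ->
    ~~ (C `<=` A n.+1) -> (forall p, p < n.+2 -> A p != C) ->
    value (A n.+2) <= value C }.

(* C is continued by the pairs {x, M}, {M, M + 1}, {M + 1, M + 2}, ... with x
   a bit of C outside A (n + 1) and M fresh. *)
Lemma extend_candidate (A : nat -> {fset nat}) n C :
  injective A -> (forall m, ~~ [disjoint A m.+1 & A m]%fset) ->
  (forall m, [disjoint A m.+2 & A m]%fset) ->
  ~~ [disjoint C & A n.+1]%fset -> [disjoint C & A n]%fset ->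
  ~~ (C `<=` A n.+1) -> (forall p, p < n.+2 -> A p != C) ->
  exists B, [/\ enots_wolley_admissible (fun m => value (B m.-1)),
    forall m, m < n.+2 -> B m = A m & B n.+2 = C].
Proof.
move=> Ainj Ameet Adisj meetC disjC /fsubsetPn[x xC xA] newC.
have [M1 hM1] := bits_bound_prefix A n.+2; have [M2 hM2] := bits_bound C.
pose M := maxn M1 M2.
have AM p i : i \in A p -> p < n.+2 -> i < M.
  by move=> ip /hM1/(_ ip) lt; rewrite leq_max lt.
have CM i : i \in C -> i < M by move=> /hM2 lt; rewrite leq_max lt orbT.
pose y t := if t is s.+1 then M + s else x.
have yM t : M <= y t.+1 by rewrite leq_addr.
have ylt s t : s < t -> y s < y t.
  by case: s t => [|s] [|t] //= st; [rewrite (leq_trans (CM x xC)) ?leq_addr|rewrite ltn_add2l].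
pose B m := if m < n.+2 then A m else if m == n.+2 then C
            else [fset y (m - n.+3); y (m - n.+3).+1].
have BA m : m < n.+2 -> B m = A m by rewrite /B => ->.
have BC : B n.+2 = C by rewrite /B ltnn eqxx.
have By t : B (n.+3 + t) = [fset y t; y t.+1].
  by rewrite /B ltnNge ltnW ?leq_addr //= gtn_eqF ?leq_addr // addKn.
have cases m : [\/ m < n.+2, m = n.+2 | exists t, m = n.+3 + t].
  case: (ltngtP m n.+2) => [||->]; [by constructor 1| |by constructor 2].
  by move=> lt; constructor 3; exists (m - n.+3); rewrite subnKC.
have Bmeet m : ~~ [disjoint B m.+1 & B m]%fset.
  case: (cases m) => [lt|->|[t ->]]; last first.
  - apply/meetP; exists (y t.+1); rewrite -?addnS !By !inE eqxx ?orbT //.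
  - by rewrite BC -[n.+3]addn0 By; apply/meetP; exists x; rewrite ?inE ?eqxx.
  - rewrite (BA m) //; move: lt; rewrite ltnS leq_eqVlt => /orP[/eqP->|lt].
      by rewrite BC.
    by rewrite BA.
have Bdisj m : [disjoint B m.+2 & B m]%fset.
  case: (cases m) => [lt|->|[t ->]]; last first.
  - rewrite -!addnS !By; apply/fdisjointP => i; rewrite !inE.
    have := ylt t t.+1; have := ylt t.+1 t.+2; have := ylt t.+2 t.+3.
    by move=> /(_ (leqnn _)) ? /(_ (leqnn _)) ? /(_ (leqnn _)) ?; lia.
  - rewrite BC -[n.+4]addn1 By; apply/fdisjointP => i; rewrite !inE => yi.
    by apply/negP => /CM; case/orP: yi => /eqP->; rewrite ltnNge yM.
  - rewrite (BA m) //; move: lt; rewrite ltnS leq_eqVlt => /orP[/eqP->|].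
      (* The first pair may follow [C] because [x] is outside [A n.+1] and [M] is fresh. *)
      rewrite -[n.+3]addn0 By; apply/fdisjointP => i; rewrite !inE => /orP[]/eqP-> //.
      by apply/negP => /AM; rewrite leqnn => /(_ isT); rewrite ltnNge yM.
    rewrite ltnS leq_eqVlt => /orP[/eqP->|lt]; first by rewrite BC.
    by rewrite BA.
have Blt m m' : m < m' -> B m != B m'.
  case: (cases m') => [lt' lt|-> lt|[t ->] lt].
  - rewrite !BA //; last exact: ltn_trans lt lt'.
    by apply/eqP => /Ainj e; rewrite e ltnn in lt.
  - by rewrite BC BA // newC.
  (* The larger bit [y t.+1] of a pair occurs in no earlier set. *)
  - apply/eqP => /fsetP /(_ (y t.+1)); rewrite By !inE eqxx orbT.
    case: (cases m) lt => [ltm _|-> _|[s -> lt]].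
    + by rewrite BA // => /AM /(_ ltm); rewrite ltnNge yM.
    + by rewrite BC => /CM; rewrite ltnNge yM.
    + rewrite By !inE; have := ylt s t.+1; have := ylt s.+1 t.+1.
      by rewrite ltn_add2l in lt; rewrite !ltnS lt (ltnW lt) => /(_ isT) ? /(_ isT) ?; lia.
have Binj : injective B.
  by move=> m m' e; case: (ltngtP m m') => // /Blt; rewrite e eqxx.
exists B; split=> //; apply: admissible_value => // m.
by have /meetP[i _ ib] := Bmeet m; apply/fset0Pn; exists i.
Qed.

(** A smaller candidate [C] would extend to an admissible sequence that agrees with [a] before index
    [n.+3] and is smaller there, against lexicographic minimality. *)
Lemma greedy_sets_supp a :
  binary_enots_wolley a -> greedy_sets (fun n => supp (a n.+1)).
Proof.
move=> [[apos ainj ameet adisj] amin]; pose A n := supp (a n.+1); rewrite -/A.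
have Ainj : injective A by move=> m n /supp_inj e; have [] := ainj m.+1 n.+1 isT isT e.
have Ameet n : ~~ [disjoint A n.+1 & A n]%fset by have := ameet n.+2 isT; rewrite subn1.
have Adisj n : [disjoint A n.+2 & A n]%fset by have := adisj n.+3 isT; rewrite subn2 => /eqP.
split=> // n C meetC disjC subC newC.
have [B [/amin leB BA BC]] := extend_candidate Ainj Ameet Adisj meetC disjC subC newC.
have aB m : 0 < m < n.+3 -> a m = value (B m.-1).
  by case: m => // m /andP[_]; rewrite ltnS => /BA ->; rewrite value_supp.
rewrite /A value_supp -BC.
case: leB => [/(_ n.+3 isT) -> //|[m [m1 eqm ltm]]].
case: (ltngtP m n.+3) => [lt|lt|e].
- by rewrite aB ?ltnn ?m1 in ltm.
- by rewrite (eqm n.+3).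
- by rewrite e in ltm; apply: ltnW.
Qed.

(** * Consequences of the greedy rule *)

Lemma gs_nsub A n : greedy_sets A -> ~~ (A n.+1 `<=` A n).
Proof.
move=> gA; have /meetP[x x2 x1] := gs_meet gA n.+1.
by apply/fsubsetPn; exists x => //; apply: (fdisjointP (gs_disj gA n)).
Qed.

Lemma gs_used A n C : greedy_sets A -> ~~ [disjoint C & A n.+1]%fset ->
  [disjoint C & A n]%fset -> ~~ (C `<=` A n.+1) -> value C < value (A n.+2) ->
  exists2 p, p < n.+2 & A p = C.
Proof.
move=> gA meetC disjC subC lt; apply: NNPP => new.
move: lt; rewrite ltnNge (gs_min gA) // => p pn.
by apply/eqP => e; apply: new; exists p.
Qed.

(** A proper subset has smaller value and inherits disjointness from [A n]. *)
Lemma gs_subset_used A n C : greedy_sets A -> C `<` A n.+2 ->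
  ~~ [disjoint C & A n.+1]%fset -> ~~ (C `<=` A n.+1) ->
  exists2 p, p < n.+2 & A p = C.
Proof.
move=> gA ltC meetC subC; apply: gs_used => //; last exact: value_proper.
exact: fdisjointWl (fproper_sub ltC) (gs_disj gA n).
Qed.

(** Each value is taken at most once, so raising [b] by one costs at most moving past one index. *)
Lemma gs_unbounded A b : greedy_sets A ->
  exists N, forall n, N <= n -> b < value (A n).
Proof.
move=> gA; elim: b => [|b [N hN]].
  have [e|[n0 h0]] : (forall n, 0 < value (A n)) \/ exists n, value (A n) = 0.
  - apply: NNPP => /not_or_and[/not_all_ex_not[n hn] h]; apply: h; exists n.
    by apply/eqP; rewrite -leqn0 leqNgt; apply/negP.
  - by exists 0 => n _.
  - exists n0.+1 => n ltn; rewrite lt0n; apply/eqP => h.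
    by move: ltn; rewrite (gs_inj gA (value_inj (etrans h (esym h0)))) ltnn.
have [[n0 h0]|none] := classic (exists n, value (A n) = b.+1).
  exists (maxn N n0.+1) => n; rewrite geq_max => /andP[/hN lt ltn].
  rewrite ltn_neqAle lt andbT; apply/eqP => h.
  by move: ltn; rewrite (gs_inj gA (value_inj (etrans (esym h) (esym h0)))) ltnn.
exists N => n /hN lt; rewrite ltn_neqAle lt andbT; apply/eqP => h.
by apply: none; exists n.
Qed.

(** * Every bit occurs infinitely often *)

Lemma gs_first_bit A N : greedy_sets A ->
  exists M n i, [/\ N <= M, N <= n, A n.+2 = [fset i; M], i \in A n.+1 &
    forall p x, p < n.+2 -> x \in A p -> x < M].
Proof.
(* The first [N.+2] terms are at most [M < 2 ^ M], so the first term reaching [2 ^ M] comes later;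
   all terms before it have bits below [M] only. *)
move=> gA; pose M := N + \max_(p < N.+2) value (A p).
have small p : p < N.+2 -> value (A p) < 2 ^ M.
  move=> pN; apply: leq_ltn_trans (ltn_expl M (ltnSn 1)).
  exact: leq_trans (leq_bigmax (Ordinal pN)) (leq_addl _ _).
have [n1 hn1] := gs_unbounded (2 ^ M) gA.
have ex : exists n, 2 ^ M <= value (A n) by exists n1; apply/ltnW/hn1.
case: (ex_minnP ex) => n gen minn.
have : N.+2 <= n by rewrite leqNgt; apply/negP => /small; rewrite ltnNge gen.
case: n gen minn => [|[|n]] // gen minn; rewrite !ltnS => Nn.
have AM p x : p < n.+2 -> x \in A p -> x < M.
  move=> pn /exp2_le_value le; rewrite -(@ltn_exp2l 2) // (leq_ltn_trans le) // ltnNge.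
  by apply/negP => /minn; rewrite leqNgt pn.
have newM C p : M \in C -> p < n.+2 -> A p <> C.
  by move=> MC pn e; rewrite -e in MC; have := AM p M pn MC; rewrite ltnn.
have pair i : i \in A n.+1 -> [/\ i != M, ~~ [disjoint [fset i; M] & A n.+1]%fset &
    ~~ ([fset i; M] `<=` A n.+1)].
  move=> iA; have ltiM := AM _ _ (ltnSn _) iA.
  rewrite (ltn_eqF ltiM); split=> //.
    by apply/meetP; exists i; rewrite ?inE ?eqxx.
  apply/fsubsetPn; exists M; first by rewrite !inE eqxx orbT.
  by apply/negP => /(AM _ _ (ltnSn _)); rewrite ltnn.
(* For [i] in [A n.+1] but not in [A n], the new candidate [[fset i; M]] bounds [A n.+2] by
   [2 ^ i + 2 ^ M < 2 ^ M.+1], so [M] is its top bit. *)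
have MA : M \in A n.+2.
  have /fsubsetPn[i i1 i0] := gs_nsub n gA.
  have [niM meeti subi] := pair i i1.
  apply: mem_top_bit; rewrite gen /=; apply: (@leq_ltn_trans (2 ^ i + 2 ^ M)).
    rewrite leqNgt; apply/negP; rewrite -value_fset2 // => lt.
    case: (gs_used gA meeti _ subi lt) => [|p pn /newM]; last by apply; rewrite // !inE eqxx orbT.
    apply/fdisjointP => x; rewrite !inE => /orP[]/eqP-> //.
    by apply/negP => /AM; rewrite ltnn => /(_ (ltnW (ltnSn _))).
  by rewrite expnS mul2n -addnn ltn_add2r ltn_exp2l // (AM _ _ _ i1).
(* Now [i] is a shared bit: were [[fset i; M]] a proper subset of [A n.+2], it would be an earlier
   term, but [M] is new. *)
have /meetP[i i2 i1] := gs_meet gA n.+1.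
have [niM meeti subi] := pair i i1.
exists M, n, i; split=> //; first exact: leq_addr.
apply/eqP; apply/negPn/negP => ne.
have lt : [fset i; M] `<` A n.+2.
  rewrite fproperEneq eq_sym ne; apply/fsubsetP => x.
  by rewrite !inE => /orP[]/eqP->.
have [p pn /newM] := gs_subset_used gA lt meeti subi.
by apply; rewrite // !inE eqxx orbT.
Qed.

(* When the bit M first occurs, in A (n + 2) = {i, M}, the next term contains M
   and, if j no longer occurs, is at most {j, M}; it then shares with
   A (n + 4) a bit j' <= j, and {j', j, v} is a bounded candidate for A (n + 4). *)
Lemma gs_bit_recurs A j N : greedy_sets A -> exists2 n, N <= n & j \in A n.
Proof.
move=> gA; apply: NNPP => h.
have nj n : N <= n -> j \notin A n by move=> Nn; apply/negP => jn; apply: h; exists n.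
(* Terms before [N] have bits below [V] only and later ones lack [j], so any set containing [j] and
   some [v >= V] is new. *)
have [V hV] := bits_bound_prefix A N.
pose B := 2 ^ j + (2 ^ j + 2 ^ V.+1).
have [N' hN'] := gs_unbounded B gA.
have [M [n [i [leM len An2 iA AM]]]] := gs_first_bit (maxn (maxn N N') V.+2) gA.
move: leM len; rewrite !geq_max => /andP[/andP[_ _] VM] /andP[/andP[Nn N'n] _].
have ltiM : i < M by apply: AM iA.
have M3 : M \in A n.+3.
  have /meetP[y y3] := gs_meet gA n.+2; rewrite An2 !inE => /orP[]/eqP e; last by rewrite -e.
  by rewrite e in y3; have := fdisjointP (gs_disj gA n.+1) _ y3; rewrite iA.
have nij : i != j by apply: contraTneq iA => ->; rewrite nj // ltnW // ltnS ltnW.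
have njM : j != M by apply: contraTneq M3 => <-; rewrite nj // !(leqW, Nn).
have le3 : value (A n.+3) <= 2 ^ j + 2 ^ M.
  rewrite -value_fset2 //; apply: gs_min => //.
  - by apply/meetP; exists M; rewrite ?An2 !inE eqxx orbT.
  - apply/fdisjointP => x; rewrite !inE => /orP[]/eqP->; first by rewrite nj // leqW.
    by apply/negP => /(AM _ _ (ltnSn _)); rewrite ltnn.
  - by apply/fsubsetPn; exists j; rewrite ?inE ?eqxx // An2 !inE negb_or eq_sym nij.
  - move=> p; rewrite ltnS leq_eqVlt => /orP[/eqP->|pn].
      apply: contraNneq (nj n.+2 _) => [->|]; last by rewrite !leqW.
      by rewrite !inE eqxx.
    apply/eqP => e; have := AM p M pn; rewrite e !inE eqxx orbT ltnn.
    by move=> /(_ isT).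
have /meetP[j' j4 j3] := gs_meet gA n.+3.
have : j' \notin A n.+2 := fdisjointP (gs_disj gA n.+2) _ j4.
rewrite An2 !inE negb_or => /andP[nj'i nj'M].
have le_j'j : j' <= j.
  rewrite -(@leq_exp2l 2) // -(leq_add2r (2 ^ M)) (leq_trans _ le3) //.
  by rewrite -value_fset2 // value_subset //; apply/fsubsetP => x; rewrite !inE => /orP[]/eqP->.
(* The candidate must avoid [A n.+2], which is [[fset i; M]]; two choices suffice to avoid [i], and
   both lie below [M]. *)
pose v := if i == V then V.+1 else V.
have leVv : V <= v by rewrite /v; case: ifP => // _; exact: leqnSn.
have levV : v <= V.+1 by rewrite /v; case: ifP => // _; exact: leqnSn.
have nvi : v != i by rewrite /v; case: (i =P V) => [->|/eqP ne]; [rewrite gtn_eqF|rewrite eq_sym].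
have nvM : v != M by rewrite ltn_eqF // (leq_ltn_trans levV).
have := hN' n.+4 (leqW (leqW (leqW (leqW N'n)))); rewrite ltnNge => /negP; apply.
apply: (@leq_trans (value (j' |` (j |` [fset v])))).
  apply: gs_min => //.
  - by apply/meetP; exists j'; rewrite // !inE eqxx.
  - apply/fdisjointP => x; rewrite An2 !inE negb_or => /or3P[]/eqP->; rewrite ?nj'i ?nvi ?nvM //.
    by rewrite eq_sym nij njM.
  - apply/fsubsetPn; exists j; first by rewrite !inE eqxx orbT.
    by rewrite nj // !leqW.
  - move=> p _; apply/eqP => /fsetP e; case: (ltnP p N) => pN.
      have := hV p v pN; rewrite e !inE eqxx !orbT => /(_ isT).
      by rewrite ltnNge leVv.
    by have := nj p pN; rewrite e !inE eqxx !orbT.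
apply: leq_trans (value_fsetU1_le _ _) _; apply: leq_add; first by rewrite leq_exp2l.
apply: leq_trans (value_fsetU1_le _ _) _; rewrite leq_add2l value_fset1.
by rewrite leq_exp2l.
Qed.

(** * Missing sets of at least two bits *)

Lemma count_unbounded (P : pred nat) c :
  (forall N, exists2 n, N <= n & P n) -> exists N, c <= count P (iota 0 N).
Proof.
move=> infP; elim: c => [|c [N cN]]; first by exists 0.
have [n Nn Pn] := infP N; exists n.+1.
rewrite -(subnKC Nn) -addnS iotaD count_cat add0n -addn1 leq_add // -has_count.
by apply/hasP; exists n => //; rewrite mem_iota Nn addnS ltnS subnKC /=.
Qed.

(* Otherwise K meets the terms in short blocks, each preceded by a term disjoint
   from K and opening with a superset A (n + 1) of K, for infinitely many n.
   Removing x or y from A (n + 1) gives two smaller candidates, so both are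
   earlier terms; they meet K in a proper subset, so each is the second term of
   a block. Hence h blocks require 2 h - O(1) earlier ones. *)
Lemma gs_missing_meets A (K : {fset nat}) x y : greedy_sets A ->
  (forall n, A n <> K) -> x \in K -> y \in K -> x != y ->
  exists N, forall n, N <= n -> ~~ [disjoint A n & K]%fset.
Proof.
move=> gA misK xK yK nxy; apply: NNPP => nex.
pose e n := [disjoint A n & K]%fset.
have inf_e N : exists2 n, N <= n & e n.
  apply: NNPP => h; apply: nex; exists N => n Nn; apply/negP => en.
  by apply: h; exists n.
have inf_ne N : exists2 n, N <= n & ~~ e n.
  have [n Nn xn] := gs_bit_recurs x N gA.
  by exists n => //; apply/meetP; exists x.
have [N1 hN1] := gs_unbounded (value K) gA.
(* Otherwise [K] is a candidate for [A n.+2] of smaller value, hence an earlier term. *)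
have start n : N1 <= n -> e n -> ~~ e n.+1 -> K `<=` A n.+1.
  move=> Nn en ne; apply/negPn/negP => nsub.
  have [p _ /misK//] : exists2 p, p < n.+2 & A p = K.
  by apply: gs_used; rewrite // 1?fdisjoint_sym // hN1 // !leqW.
have [q N1q eq] := inf_e N1.+1.
(* A block opens with a superset of [K], and the term two places later is disjoint from that
   superset, so a block has at most two terms. *)
have short r : q <= r -> [|| e r, e r.+1 | e r.+2].
  move=> /subnKC <-; elim: (r - q) => [|t]; first by rewrite addn0 eq.
  rewrite addnS; move: (q + t) (leq_addr t q) => s qs.
  case: (boolP (e s.+1)) => //= e1; case: (boolP (e s.+2)) => //= e2.
  rewrite orbF => es; have Ks := start s (leq_trans (ltnW N1q) qs) es e1.
  rewrite /e fdisjoint_sym; apply: fdisjointWl Ks _.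
  by rewrite fdisjoint_sym gs_disj.
pose hit n := [&& q <= n, e n & ~~ e n.+1].
have inf_hit N : exists2 n, N <= n & hit n.
  have [p le_p ep] := inf_e (maxn N q).
  have ex : exists n, (p <= n) && ~~ e n by have [n pn en] := inf_ne p; exists n; rewrite pn.
  case: (ex_minnP ex) => -[|n] /andP[pn en] minn; first by move: pn en ep; rewrite leqn0 => /eqP->/negP.
  have {}pn : p <= n.
    by move: pn; rewrite leq_eqVlt ltnS => /orP[/eqP pn|//]; rewrite pn (negbTE en) in ep.
  move: le_p; rewrite geq_max => /andP[Np qp].
  exists n; first exact: leq_trans pn.
  rewrite /hit en (leq_trans qp pn) andbT /=; apply/negPn/negP => en'.
  by have := minn n; rewrite pn en' ltnn => /(_ isT).
have hitK n : hit n -> K `<=` A n.+1.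
  by move=> /and3P[qn en en']; apply: start => //; apply: leq_trans qn; apply: ltnW.
(* [A n] is disjoint from [K], so deleting [z] keeps the bits shared with [A n], while [w] remains
   outside [A n]. *)
have used n z w : hit n -> z \in K -> w \in K -> z != w ->
    exists2 p, p < n.+1 & A p = A n.+1 `\ z.
  move=> hn zK wK nzw; have /fsubsetP Kn := hitK n hn; move: hn => /and3P[qn en _].
  have en' u : u \in K -> u \notin A n.
    by move=> uK; apply: (fdisjointP _ _ uK); rewrite fdisjoint_sym.
  case: n qn en Kn en' => [|n] qn en Kn en'; first by have := leq_trans N1q qn.
  apply: gs_subset_used => //.
  - exact/fproperD1/Kn.
  - have /meetP[u u2 u1] := gs_meet gA n.+1; apply/meetP; exists u => //.
    by rewrite !inE u2 andbT; apply: contraTneq u1 => ->; apply: en'.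
  - by apply/fsubsetPn; exists w; rewrite ?en' // !inE eq_sym nzw Kn.
(* [A p] contains [w] but not [z], so by [start] it does not open a block; by [short] it is the
   second term of one, preceded by index [p.-2]. *)
have used_hit n z w p : hit n -> z \in K -> w \in K -> z != w -> q.+2 <= p ->
    A p = A n.+1 `\ z -> hit p.-2.
  move=> hn zK wK nzw; case: p => [|[|p]] //; rewrite !ltnS => qp Ap.
  have /fsubsetP Kn := hitK n hn.
  have e2 : ~~ e p.+2 by apply/meetP; exists w; rewrite // Ap !inE eq_sym nzw Kn.
  have e1 : ~~ e p.+1.
    apply/negP => e1; have /fsubsetP/(_ z zK) := start p.+1 (leqW (leq_trans (ltnW N1q) qp)) e1 e2.
    by rewrite Ap !inE eqxx.
  have := short p qp; rewrite (negbTE e1) (negbTE e2) !orbF => e0.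
  by rewrite /hit /= qp e0 e1.
(* With [h] hits below [N], the [2 h] deleted sets are distinct and lie among [q.+2] early terms and
   [h] second terms, so [h <= q.+2]. *)
have [N] := count_unbounded (q.+3) inf_hit.
rewrite -size_filter; set s := [seq n <- iota 0 N | hit n] => big.
pose rm z := [seq A n.+1 `\ z | n <- s].
have sN n : n \in s = hit n && (n < N) by rewrite mem_filter mem_iota add0n.
have uniq_rm z : z \in K -> uniq (rm z).
  move=> zK; rewrite map_inj_in_uniq ?filter_uniq ?iota_uniq // => m n.
  rewrite !sN => /andP[/hitK/fsubsetP/(_ z zK) zm _] /andP[/hitK/fsubsetP/(_ z zK) zn _] E.
  by have := gs_inj gA (etrans (esym (fsetD1K zm)) (etrans (congr1 _ E) (fsetD1K zn))) => -[].
have sub_rm z w : z \in K -> w \in K -> z != w ->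
    {subset rm z <= [seq A p | p <- iota 0 q.+2] ++ [seq A n.+2 | n <- s]}.
  move=> zK wK nzw C /mapP[n]; rewrite sN => /andP[hn nN] ->.
  have [p pn Ap] := used n z w hn zK wK nzw; rewrite -Ap mem_cat.
  case: (ltnP p q.+2) => [pq|qp]; first by rewrite map_f // mem_iota add0n.
  have hp := used_hit n z w p hn zK wK nzw qp Ap.
  case: p qp hp pn {Ap} => [|[|p]] //= qp hp pn.
  by rewrite (@map_f _ _ (fun n => A n.+2)) ?orbT // sN hp; lia.
have uniq_xy : uniq (rm x ++ rm y).
  rewrite cat_uniq !uniq_rm // andbT; apply/hasPn => _ /mapP[n + ->].
  rewrite sN => /andP[/hitK/fsubsetP/(_ x xK) xn _].
  apply/negP => /mapP[m _ /fsetP/(_ x)]; by rewrite !inE eqxx nxy xn.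
have sub_xy : {subset rm x ++ rm y <= [seq A p | p <- iota 0 q.+2] ++ [seq A n.+2 | n <- s]}.
  move=> C; rewrite mem_cat => /orP[]; first exact: sub_rm xK yK nxy C.
  by apply: (sub_rm y x) => //; rewrite eq_sym.
have := uniq_leq_size uniq_xy sub_xy; rewrite !size_cat !size_map size_iota; lia.
Qed.

(* If K is missing, then so is every pair of large bits, because the pair is
   disjoint from K. So each late term contains at least two of the bits M, M + 1
   and M + 2, which is impossible for two terms at distance two. *)
Lemma gs_exhaustive A (K : {fset nat}) x y : greedy_sets A ->
  x \in K -> y \in K -> x != y -> exists n, A n = K.
Proof.
move=> gA xK yK nxy; apply: NNPP => missing.
have [|N meetK] := gs_missing_meets gA _ xK yK nxy.
  by move=> n e; apply: missing; exists n.
have [M1 hM1] := bits_bound_prefix A N; have [M2 hM2] := bits_bound K.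
pose M := maxn M1 M2.
have pair u v : M <= u < v ->
    exists N', forall n, N' <= n -> (u \in A n) || (v \in A n).
  move=> /andP[Mu ltuv]; have Mv := leq_trans Mu (ltnW ltuv).
  have [||||N' hN'] := @gs_missing_meets A [fset u; v] u v gA.
  (* Before [N] no term has a bit as large as [u]; from [N] on every term has a bit of [K], hence
     one below [M]. *)
  - move=> n e; case: (ltnP n N) => nN.
      have := hM1 n u nN; rewrite e !inE eqxx => /(_ isT).
      by rewrite ltnNge (leq_trans _ Mu) // leq_maxl.
    have /meetP[w] := meetK n nN; rewrite e !inE => wuv /hM2.
    by rewrite ltnNge (leq_trans (leq_maxr M1 M2)) //; case/orP: wuv => /eqP->.
  - by rewrite !inE eqxx.
  - by rewrite !inE eqxx orbT.
  - by rewrite ltn_eqF.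
  exists N' => n /hN'/meetP[w wA]; rewrite !inE => /orP[]/eqP<-; by rewrite wA ?orbT.
have [|Na ha] := pair M M.+1; first by rewrite leqnn /=.
have [|Nb hb] := pair M M.+2; first by rewrite leqnn /=.
have [|Nc hc] := pair M.+1 M.+2; first by rewrite leqnSn /=.
pose n := Na + Nb + Nc.
have [na nb nc] : [/\ Na <= n, Nb <= n & Nc <= n] by split; rewrite /n; lia.
have disj u : u \in A n.+2 -> u \in A n -> False.
  by move=> /(fdisjointP (gs_disj gA n))/negP.
have := (ha _ na, hb _ nb, hc _ nc).
have := (ha _ (leqW (leqW na)), hb _ (leqW (leqW nb)), hc _ (leqW (leqW nc))).
move: (disj M) (disj M.+1) (disj M.+2).
do 3![case: (_ \in A n.+2)]; do 3![case: (_ \in A n)] => d0 d1 d2 [[h1 h2] h3] [[h4 h5] h6] //;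
  by [apply: d0|apply: d1|apply: d2].
Qed.

Theorem theorem5 (a : nat -> nat) (ha : binary_enots_wolley a)
    (n : nat) (hn : 0 < n) (hs : 2 <= s2 n) :
  exists i, 1 <= i /\ a i = n.
Proof.
have /fset0Pn[x xK] : supp n != fset0 by rewrite -cardfs_gt0 (leq_trans _ hs).
have /fset0Pn[y] : supp n `\ x != fset0.
  by rewrite -cardfs_gt0; have := cardfsD1 x (supp n); rewrite xK; move: hs; rewrite /s2; lia.
rewrite in_fsetD1 eq_sym => /andP[nxy yK].
have [m /supp_inj <-] := gs_exhaustive (greedy_sets_supp ha) xK yK nxy.
by exists m.+1.
Qed.
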